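(* Let $p$ be a prime, let $V$ be a vector space over $\mathbb{Q}_p$ of dimension $n>0$, let $N$ be a norm on $V$, let $e_1,\dots,e_n$ be an $N$-orthogonal basis of $V$, and let $\mathcal{L}=\mathcal{L}(\alpha_1,\dots,\alpha_m)$ be a $p$-adic lattice of rank $m\le n$ in $V$. Throughout, write $\alpha_l=\sum_{j=1}^n a_{lj}e_j$ for the current vectors $\alpha_l$ with respect to the current ordering of $e_1,\dots,e_n$. Consider the following procedure: for $i=1,\dots,m$: (a) reorder $\alpha_i,\dots,\alpha_m$ so that $N(\alpha_i)=\max_{i\le k\le m}N(\alpha_k)$; (b) reorder $e_i,\dots,e_n$ so that $N(a_{ii}e_i)=\max_{i\le j\le n}N(a_{ij}e_j)$; (c) for $l=i+1,\dots,m$ replace $\alpha_l$ by $\alpha_l-\frac{a_{li}}{a_{ii}}\alpha_i$. Then this procedure is well defined (all coefficients $a_{li}/a_{ii}$ lie in $\mathbb{Z}_p$) and the final vectors $\alpha_1,\dots,\alpha_m$ form an $N$-orthogonal basis of $\mathcal{L}$.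
   Context: A norm on a $\mathbb{Q}_p$-vector space $V$ is a function $N:V\to\mathbb{R}$ with $N(v)\ge0$, $N(v)=0$ iff $v=0$; $N(xv)=|x|_p N(v)$ for $x\in\mathbb{Q}_p$; and $N(v+w)\le\max\{N(v),N(w)\}$. Linearly independent vectors $\beta_1,\dots,\beta_k$ are an $N$-orthogonal basis of the subspace they span (in particular of $V$ when $k=\dim V$) if $N(\sum_i x_i\beta_i)=\max_i N(x_i\beta_i)$ for all $x_i\in\mathbb{Q}_p$. For $\mathbb{Q}_p$-linearly independent $\alpha_1,\dots,\alpha_m\in V$, the $p$-adic lattice $\mathcal{L}(\alpha_1,\dots,\alpha_m)=\{\sum_{i=1}^m a_i\alpha_i: a_i\in\mathbb{Z}_p\}$ has basis $\alpha_1,\dots,\alpha_m$ and rank $m$; an $N$-orthogonal basis of the lattice is a lattice basis that is an $N$-orthogonal basis of the span of $\mathcal{L}$. *)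

(* Defs.v *)
From HB Require Import structures.
From mathcomp Require Import all_boot all_order all_fingroup all_algebra.
From mathcomp Require Import boolp classical_sets reals.

Set Implicit Arguments.
Unset Strict Implicit.
Unset Printing Implicit Defensive.

Import Order.TTheory GRing.Theory Num.Theory.
Local Open Scope ring_scope.

(* Z_p as the inverse limit of the rings Z/p^n: [residue x n] is the canonical
   representative (in 0, ..., p^n - 1) of x modulo p^n. The primality proof is
   an argument of the type so that the ring instances can be canonical. *)
Record padic_int (p : nat) (p_pr : prime p) := PadicInt {
  residue : nat -> nat;
  residue_modn : forall n, (residue n.+1 %% p ^ n)%N = residue n }.

Section PadicInt.
Local Open Scope nat_scope.
Variables (p : nat) (p_pr : prime p).
Local Notation Zp := (padic_int p_pr).
Implicit Types (x y z : Zp) (f : nat -> nat).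

HB.instance Definition _ := gen_eqMixin Zp.
HB.instance Definition _ := gen_choiceMixin Zp.

Lemma padic_intP x y : (forall n, residue x n = residue y n) -> x = y.
Proof.
case: x y => [f cf] [g cg] /= /funext eqfg; rewrite -{}eqfg in cg *.
by rewrite (Prop_irrelevance cf cg).
Qed.

Lemma residue_le x k n : k <= n -> residue x n %% p ^ k = residue x k.
Proof.
move=> /subnK <-; elim: (n - k) => [|d IHd].
  by rewrite add0n -residue_modn modn_mod.
rewrite addSn -IHd -(residue_modn x (d + k)) modn_dvdm //.
by rewrite dvdn_exp2l // leq_addl.
Qed.

Lemma residue_mod x n : residue x n %% p ^ n = residue x n.
Proof. exact: residue_le. Qed.

Lemma coherent_modn f : (forall n, f n.+1 = f n %[mod p ^ n]) ->
  forall n, (f n.+1 %% p ^ n.+1) %% p ^ n = f n %% p ^ n.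
Proof. by move=> fP n; rewrite modn_dvdm ?fP // dvdn_exp2l. Qed.

Definition padic_int_of f (fP : forall n, f n.+1 = f n %[mod p ^ n]) : Zp :=
  PadicInt p_pr (coherent_modn fP).

Lemma natr_coherent k n : k = k %[mod p ^ n]. Proof. by []. Qed.

Lemma opp_coherent x n :
  p ^ n.+1 - residue x n.+1 = p ^ n - residue x n %[mod p ^ n].
Proof.
have leq_residue m : residue x m <= p ^ m.
  by rewrite -residue_mod ltnW // ltn_pmod // expn_gt0 prime_gt0.
apply/eqP; rewrite -(eqn_modDr (residue x n)) subnK // modnn.
rewrite -(residue_modn x n) modnDmr subnK //.
exact: dvdn_exp2l.
Qed.

Lemma add_coherent x y n :
  residue x n.+1 + residue y n.+1 = residue x n + residue y n %[mod p ^ n].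
Proof. by rewrite -modnDm !residue_modn. Qed.

Lemma mul_coherent x y n :
  residue x n.+1 * residue y n.+1 = residue x n * residue y n %[mod p ^ n].
Proof. by rewrite -modnMm !residue_modn. Qed.

Definition padic_int_nat k : Zp := padic_int_of (natr_coherent k).
Definition padic_int_opp x : Zp := padic_int_of (opp_coherent x).
Definition padic_int_add x y : Zp := padic_int_of (add_coherent x y).
Definition padic_int_mul x y : Zp := padic_int_of (mul_coherent x y).

Lemma padic_int_addA : associative padic_int_add.
Proof. by move=> x y z; apply: padic_intP => n /=; rewrite modnDmr modnDml addnA. Qed.

Lemma padic_int_addC : commutative padic_int_add.
Proof. by move=> x y; apply: padic_intP => n /=; rewrite addnC. Qed.

Lemma padic_int_add0 : left_id (padic_int_nat 0) padic_int_add.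
Proof. by move=> x; apply: padic_intP => n /=; rewrite modnDml residue_mod. Qed.

Lemma padic_int_addN : left_inverse (padic_int_nat 0) padic_int_opp padic_int_add.
Proof.
move=> x; apply: padic_intP => n /=; rewrite modnDml subnK ?modnn ?mod0n //.
by rewrite -residue_mod ltnW // ltn_pmod // expn_gt0 prime_gt0.
Qed.

HB.instance Definition _ := GRing.isZmodule.Build Zp
  padic_int_addA padic_int_addC padic_int_add0 padic_int_addN.

Lemma padic_int_mulA : associative padic_int_mul.
Proof. by move=> x y z; apply: padic_intP => n /=; rewrite modnMmr modnMml mulnA. Qed.

Lemma padic_int_mulC : commutative padic_int_mul.
Proof. by move=> x y; apply: padic_intP => n /=; rewrite mulnC. Qed.

Lemma padic_int_mul1 : left_id (padic_int_nat 1) padic_int_mul.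
Proof. by move=> x; apply: padic_intP => n /=; rewrite modnMml mul1n residue_mod. Qed.

Lemma padic_int_mulD : left_distributive padic_int_mul padic_int_add.
Proof.
by move=> x y z; apply: padic_intP => n /=; rewrite modnMml modnDm mulnDl.
Qed.

Lemma padic_int_1neq0 : padic_int_nat 1 != padic_int_nat 0.
Proof.
apply/eqP => /(congr1 (fun x => residue x 1)) /=.
by rewrite expn1 mod0n modn_small // prime_gt1.
Qed.

HB.instance Definition _ := GRing.Zmodule_isComNzRing.Build Zp
  padic_int_mulA padic_int_mulC padic_int_mul1 padic_int_mulD padic_int_1neq0.

Definition padic_int_unit : {pred Zp} := fun x => residue x 1 != 0.

Lemma coprime_residue x n : padic_int_unit x -> coprime (residue x n) (p ^ n).
Proof.
case: n => [|n] ux; first exact: coprimen1.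
rewrite coprimeXr // coprime_sym prime_coprime //.
by have := @residue_le x 1 n.+1 isT; rewrite expn1 /dvdn => ->.
Qed.

Definition inv_residue x n :=
  if padic_int_unit x then (egcdn (residue x n) (p ^ n)).1 else residue x n.

Lemma inv_residueP x n : padic_int_unit x ->
  inv_residue x n * residue x n = 1 %[mod p ^ n].
Proof.
move=> ux; have cxn := coprime_residue n ux; rewrite /inv_residue ux mulnC.
have [x0|x_gt0] := posnP (residue x n).
  by move: cxn; rewrite /coprime x0 gcd0n => /eqP ->; rewrite !modn1.
case: egcdnP => //= km kn; rewrite (eqP cxn) => def_km _.
by rewrite mulnC def_km modnMDl.
Qed.

Lemma inv_coherent x n : inv_residue x n.+1 = inv_residue x n %[mod p ^ n].
Proof.
have [ux|/negPf nux] := boolP (padic_int_unit x); last first.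
  by rewrite /inv_residue nux residue_modn residue_mod.
set a := inv_residue _ _; set b := inv_residue _ _.
have bx : b * residue x n = 1 %[mod p ^ n] by apply: inv_residueP.
have ax : a * residue x n = 1 %[mod p ^ n].
  rewrite -residue_modn modnMmr.
  have := congr1 (modn^~ (p ^ n)) (inv_residueP n.+1 ux).
  by rewrite !modn_dvdm ?dvdn_exp2l.
rewrite -(muln1 a) -modnMmr -bx modnMmr mulnCA -modnMmr.
by rewrite ax modnMmr muln1.
Qed.

Definition padic_int_inv x : Zp := padic_int_of (inv_coherent x).

Lemma padic_int_mulV : {in padic_int_unit, left_inverse 1%R padic_int_inv *%R}.
Proof.
move=> x ux; apply: padic_intP => n /=.
by rewrite modnMml inv_residueP.
Qed.

Lemma padic_int_unitP x y : (y * x)%R = 1%R -> padic_int_unit x.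
Proof.
move/(congr1 (fun z => residue z 1)) => /=; rewrite /padic_int_unit.
by case: (residue x 1) => //; rewrite muln0 expn1 mod0n modn_small ?prime_gt1.
Qed.

Lemma padic_int_inv_out : {in [predC padic_int_unit], padic_int_inv =1 id}.
Proof.
move=> x /negPf nux; apply: padic_intP => n /=; rewrite /inv_residue.
by rewrite -[padic_int_unit x]/(x \in padic_int_unit) nux residue_mod.
Qed.

HB.instance Definition _ := GRing.ComNzRing_hasMulInverse.Build Zp
  padic_int_mulV padic_int_unitP padic_int_inv_out.

Lemma padic_int_natE k : (k%:R)%R = padic_int_nat k.
Proof.
elim: k => [//|k IHk]; rewrite mulrSr IHk; apply: padic_intP => n /=.
by rewrite modnDm addn1.
Qed.

Lemma residue_nat k n : residue (k%:R : Zp)%R n = k %% p ^ n.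
Proof. by rewrite padic_int_natE. Qed.

Lemma padic_int_pX_neq0 v : (p%:R ^+ v : Zp)%R != 0%R.
Proof.
apply/eqP => /(congr1 (fun z => residue z v.+1)).
rewrite -natrX residue_nat /= mod0n modn_small ?ltn_exp2l ?prime_gt1 //.
by move/eqP; rewrite -leqn0 leqNgt expn_gt0 prime_gt0.
Qed.

Lemma padic_int_decomp x : x != 0%R ->
  exists v, exists2 u, u \in GRing.unit & x = (p%:R ^+ v * u)%R.
Proof.
move=> x_neq0; have ex_res : exists n, residue x n != 0.
  apply: contrapT => nex; case/eqP: x_neq0; apply: padic_intP => n /=.
  by rewrite mod0n; apply: contrapT => /eqP ?; apply: nex; exists n.
case: (ex_minnP ex_res) => [[|v] xv minv].
  by move: xv; rewrite -residue_mod modn1.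
have xv0 : residue x v = 0.
  by apply: contrapT => /eqP/minv; rewrite ltnn.
pose f n := residue x (n + v) %/ p ^ v.
have fP n : f n.+1 = f n %[mod p ^ n].
  by rewrite /f !modn_divl -expnD addSn residue_modn residue_mod.
have dvd_v n : p ^ v %| residue x (n + v).
  by rewrite /dvdn residue_le ?leq_addl ?xv0.
exists v, (padic_int_of fP).
  rewrite unfold_in /= /padic_int_unit /= /f modn_divl -expnD residue_mod.
  apply: contra xv => /eqP xv1; rewrite -(divnK (dvd_v 1)) xv1 mul0n //.
apply: padic_intP => n; rewrite -natrX padic_int_natE /=.
by rewrite modnMm mulnC divnK // residue_le // leq_addr.
Qed.

Lemma padic_int_integral : GRing.integral_domain_axiom Zp.
Proof.
move=> x y /eqP; apply: contraTT; rewrite negb_or => /andP[].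
move=> /padic_int_decomp[v [a ua ->]] /padic_int_decomp[w [b ub ->]].
rewrite mulrACA -exprD; apply/eqP => ab0.
case/eqP: (padic_int_pX_neq0 (v + w)).
by apply: (mulIr (_ : (a * b)%R \is a GRing.unit)); rewrite ?unitrM ?ua // ab0 mul0r.
Qed.

HB.instance Definition _ :=
  GRing.ComUnitRing_isIntegral.Build Zp padic_int_integral.

End PadicInt.

Notation padic p_pr := {fraction (padic_int p_pr)}.

Section Padic.
Variables (p : nat) (p_pr : prime p).
Local Notation Zp := (padic_int p_pr).
Local Notation Qp := (padic p_pr).
Local Notation "a %:F" := (@FracField.tofrac Zp a).
Implicit Types (x y : Qp) (a b u : Zp) (k : int).

(* The p-adic valuation: the k such that x = p^k u with u a unit of Z_p. It
   exists and is unique for x != 0; for x = 0 it is a junk value. *)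
Definition padic_val x : int :=
  xget 0 [set k | exists2 u : Zp, u \is a GRing.unit & x = p%:R ^ k * u%:F].

Definition padic_abs (R : realType) x : R :=
  if x == 0 then 0 else p%:R ^ (- padic_val x).

Definition is_padic_int x : Prop := exists a : Zp, x = a%:F.

Lemma padic_p_neq0 : p%:R != 0 :> Qp.
Proof.
have := padic_int_pX_neq0 p_pr 1; rewrite expr1 -tofrac_eq0.
by rewrite rmorph_nat.
Qed.

Lemma padic_fracE x : exists a, exists2 b, b != 0 & x = a%:F / b%:F.
Proof.
pose y := generic_quotient.repr x.
have d0 : \d_y != 0 by exact: denom_ratioP.
exists \n_y, \d_y => //.
rewrite -[LHS]generic_quotient.reprK -/y -[in LHS](Ratio_numden y).
unlock FracField.tofrac.
rewrite -[X in _ = _ * X]FracField.pi_inv -[RHS]FracField.pi_mul; congr (_ _).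
by rewrite /FracField.mulf /FracField.invf !(numden_Ratio, oner_neq0, mulr1, mul1r).
Qed.

Lemma padic_decomp x : x != 0 ->
  exists k, exists2 u : Zp, u \is a GRing.unit & x = p%:R ^ k * u%:F.
Proof.
have [a [b b0 ->]] := padic_fracE x.
have [->|a0 _] := eqVneq a 0; first by rewrite tofrac0 mul0r eqxx.
have [v [u uu ->]] := padic_int_decomp a0.
have [w [t ut ->]] := padic_int_decomp b0.
exists (v%:Z - w%:Z), (u / t); first by rewrite unitrM uu unitrV.
rewrite !rmorphM !rmorphXn !rmorph_nat /= rmorphV // expfzDr ?padic_p_neq0 //.
by rewrite invfM -exprnN mulrACA.
Qed.

Lemma padic_val_uniq k l u v : u \is a GRing.unit -> v \is a GRing.unit ->
  p%:R ^ k * u%:F = p%:R ^ l * v%:F :> Qp -> k = l.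
Proof.
wlog le_kl : k l u v / k <= l => [WH uu uv e|uu uv].
  by case/orP: (le_total k l) => /WH h; [|symmetry]; [apply: (h u v)|apply: (h v u)].
case: (lerP l k) => [le_lk _|lt_kl]; first by apply/eqP; rewrite eq_le le_kl.
have [d ->] : exists d : nat, l = k + d.+1%:Z.
  have d_gt0 : (0 < `|l - k|)%N by rewrite absz_gt0 subr_eq0 gt_eqF.
  exists `|l - k|.-1%N; rewrite prednK // gez0_abs ?subr_ge0 //.
  by rewrite addrCA subrr addr0.
rewrite expfzDr ?padic_p_neq0 // -mulrA.
move/(mulfI (expfz_neq0 _ padic_p_neq0)).
rewrite -exprnP -(rmorph_nat (@FracField.tofrac Zp)) -rmorphXn -rmorphM.
move/eqP; rewrite tofrac_eq => /eqP def_u.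
move: uu; rewrite def_u exprS -mulrA unitrM => /andP[up _]; move: up.
rewrite unfold_in /= /padic_int_unit residue_nat expn1 modnn //.
Qed.

Lemma padic_valE k u : u \is a GRing.unit -> padic_val (p%:R ^ k * u%:F) = k.
Proof.
move=> uu; rewrite /padic_val; case: xgetP => [l _ [v uv e]|/(_ k) []].
  by apply: (padic_val_uniq uv uu).
by exists u.
Qed.

Variable R : realType.
Local Notation abs := (@padic_abs R).

Lemma padic_pu_neq0 k u : u \is a GRing.unit -> p%:R ^ k * u%:F != 0 :> Qp.
Proof.
move=> uu; rewrite mulf_neq0 ?expfz_neq0 ?padic_p_neq0 // tofrac_eq0.
by apply: contraTneq uu => ->; rewrite unitr0.
Qed.

Lemma padic_absE k u : u \is a GRing.unit ->
  abs (p%:R ^ k * u%:F) = p%:R ^ (- k).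
Proof. by move=> uu; rewrite /padic_abs (negPf (padic_pu_neq0 _ uu)) padic_valE. Qed.

Let p0 : p%:R != 0 :> R. Proof. by rewrite pnatr_eq0 -lt0n prime_gt0. Qed.
Let p_gt1 : 1 < p%:R :> R. Proof. by rewrite ltr1n prime_gt1. Qed.

Lemma padic_abs0 : abs 0 = 0. Proof. by rewrite /padic_abs eqxx. Qed.

Lemma padic_abs1 : abs 1 = 1.
Proof. by have := padic_absE 0 (unitr1 Zp); rewrite tofrac1 mulr1 oppr0. Qed.

Lemma padic_absM x y : abs (x * y) = abs x * abs y.
Proof.
have [->|/padic_decomp[k [u uu ->]]] := eqVneq x 0; first by rewrite mul0r padic_abs0 mul0r.
have [->|/padic_decomp[l [v uv ->]]] := eqVneq y 0; first by rewrite mulr0 padic_abs0 mulr0.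
rewrite mulrACA -rmorphM -expfzDr ?padic_p_neq0 // !padic_absE ?unitrM ?uu //.
by rewrite opprD expfzDr.
Qed.

Lemma padic_abs_gt0 x : x != 0 -> 0 < abs x.
Proof. by move=> /padic_decomp[k [u uu ->]]; rewrite padic_absE // exprz_gt0 // ltr0n prime_gt0. Qed.

Lemma padic_abs_le1 x : abs x <= 1 <-> is_padic_int x.
Proof.
split=> [|[a ->]].
  have [->|/padic_decomp[k [u uu ->]]] := eqVneq x 0; first by exists 0; rewrite tofrac0.
  rewrite padic_absE // -(expr0z (p%:R : R)) ler_eXz2l // oppr_le0.
  case: k => // k _; exists (p%:R ^+ k * u).
  by rewrite rmorphM rmorphXn rmorph_nat.
have [->|a0] := eqVneq a 0; first by rewrite tofrac0 padic_abs0.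
have [v [u uu ->]] := padic_int_decomp a0.
rewrite rmorphM rmorphXn rmorph_nat /= exprnP padic_absE //.
by rewrite -(expr0z (p%:R : R)) ler_eXz2l // oppr_le0.
Qed.

Lemma padic_absD x y : abs (x + y) <= Num.max (abs x) (abs y).
Proof.
have [->|y0] := eqVneq y 0; first by rewrite addr0 le_max lexx.
wlog le_xy : x y y0 / abs x <= abs y => [WH|].
  have [->|x0] := eqVneq x 0; first by rewrite add0r le_max lexx orbT.
  by case/orP: (le_total (abs x) (abs y)) => /WH h; [|rewrite addrC maxC]; apply: h.
rewrite le_max; apply/orP; right.
rewrite -{1}(divfK y0 x) -{3}(mul1r y) -mulrDl padic_absM.
rewrite ler_piMl ?(ltW (padic_abs_gt0 y0)) //; apply/padic_abs_le1.
have [a ->] : is_padic_int (x / y).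
  apply/padic_abs_le1; rewrite -(ler_pM2r (padic_abs_gt0 y0)) -padic_absM.
  by rewrite divfK // mul1r.
by exists (a + 1); rewrite rmorphD rmorph1.
Qed.

End Padic.

Section Norm.
Variables (R : realType) (p : nat) (p_pr : prime p).
Local Notation Zp := (padic_int p_pr).
Local Notation Qp := (padic p_pr).
Variable V : vectType Qp.
Implicit Types (N : V -> R) (v w : V) (U : {vspace V}) (L : set V).

Record is_norm N : Prop := IsNorm {
  norm_ge0 : forall v, 0 <= N v;
  norm_eq0 : forall v, N v = 0 <-> v = 0;
  normZ : forall (x : Qp) v, N (x *: v) = padic_abs R x * N v;
  normD : forall v w, N (v + w) <= Num.max (N v) (N w) }.

(* Norms are nonnegative, so 0 is a harmless default value for maxima. *)
Definition orthogonal_basis N k U (b : k.-tuple V) : Prop :=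
  basis_of U b /\
  forall x : 'I_k -> Qp,
    N (\sum_(i < k) x i *: tnth b i) =
    \big[Num.max/0]_(i < k) N (x i *: tnth b i).

Definition lattice k (b : k.-tuple V) : set V :=
  [set v | exists a : 'I_k -> Zp,
     v = \sum_(i < k) FracField.tofrac (a i) *: tnth b i].

Definition lattice_basis L k (b : k.-tuple V) : Prop :=
  free b /\ L = lattice b.

(* <<b>> is the span of L as soon as b is a basis of L. *)
Definition orthogonal_lattice_basis N L k (b : k.-tuple V) : Prop :=
  lattice_basis L b /\ orthogonal_basis N <<b>>%VS b.

Section Procedure.
Variables (N : V -> R) (m n : nat) (le_mn : (m <= n)%N).
Implicit Types (al : m.-tuple V) (e : n.-tuple V).

Definition reorders_from k (i : 'I_k) (b b' : k.-tuple V) : Prop :=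
  exists s : 'S_k, perm_on [set j : 'I_k | (i <= j)%N]%SET s /\
    b' = [tuple tnth b (s j) | j < k].

Definition step_a (i : 'I_m) al al' : Prop :=
  reorders_from i al al' /\
  N (tnth al' i) = \big[Num.max/0]_(k < m | (i <= k)%N) N (tnth al' k).

(* The coefficient a_{lj} of al_l with respect to e is coord e j (tnth al l);
   the column index matching the row i is widen_ord le_mn i. *)
Definition step_b (i : 'I_m) al e e' : Prop :=
  let i' := widen_ord le_mn i in
  let a j := coord e' j (tnth al i) in
  reorders_from i' e e' /\
  N (a i' *: tnth e' i') =
    \big[Num.max/0]_(j < n | (i <= j)%N) N (a j *: tnth e' j).

Definition pivot al e (i : 'I_m) : Qp :=
  coord e (widen_ord le_mn i) (tnth al i).

Definition multiplier al e (i l : 'I_m) : Qp :=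
  coord e (widen_ord le_mn i) (tnth al l) / pivot al e i.

Definition step_c (i : 'I_m) al e : m.-tuple V :=
  [tuple if (i < l)%N then tnth al l - multiplier al e i l *: tnth al i
         else tnth al l | l < m].

(* [run al e k al' e']: executing the first k passes of the loop from the state
   (al, e) may lead to (al', e'). The procedure is nondeterministic, since ties
   in the maxima and the order of the other vectors are left open. *)
Inductive run al e : nat -> m.-tuple V -> n.-tuple V -> Prop :=
| run0 : run al e 0 al e
| runS (i : 'I_m) al0 e0 al1 e1 :
    run al e i al0 e0 -> step_a i al0 al1 -> step_b i al1 e0 e1 ->
    run al e i.+1 (step_c i al1 e1) e1.

(* No pass can get stuck, and every division is legitimate and integral. *)
Definition well_defined al e : Prop :=
  forall (i : 'I_m) al0 e0, run al e i al0 e0 ->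
    (exists al1, step_a i al0 al1) /\
    forall al1, step_a i al0 al1 ->
      (exists e1, step_b i al1 e0 e1) /\
      forall e1, step_b i al1 e0 e1 ->
        pivot al1 e1 i != 0 /\
        forall l : 'I_m, (i < l)%N -> is_padic_int (multiplier al1 e1 i l).

End Procedure.
End Norm.

(* Main.v *)
(* In the final state the coefficient matrix (a_lj) is upper triangular and
   N(beta_l) = N(a_ll e_l). Given x, let l be the least index for which
   N(x_l beta_l) is the maximum M. In column l, the rows k > l vanish and the
   rows k < l contribute less than M, so by the ultrametric inequality the
   e_l-component of sum_k x_k beta_k has norm exactly M; hence so does the sum.
   The multipliers are integral because
   N(a_li e_i) <= N(alpha_l) <= N(alpha_i) = N(a_ii e_i). *)
Require Import Defs.
From mathcomp Require Import all_boot all_order all_fingroup all_algebra.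
From mathcomp Require Import boolp classical_sets reals.
Import Order.TTheory GRing.Theory Num.Theory.
Local Open Scope ring_scope.

Set Implicit Arguments.
Unset Strict Implicit.

(** * Permutations fixing an initial segment of indices *)

Lemma perm_from_ltn k (i : 'I_k) (s : 'S_k) (j : 'I_k) :
  perm_on [set j : 'I_k | (i <= j)%N]%SET s -> (j < i)%N -> s j = j.
Proof. by move=> s_on ji; rewrite (out_perm s_on) // inE -ltnNge. Qed.

Lemma perm_from_leq k (i : 'I_k) (s : 'S_k) (j : 'I_k) :
  perm_on [set j : 'I_k | (i <= j)%N]%SET s -> (i <= s j)%N = (i <= j)%N.
Proof. by move=> s_on; have := perm_closed j s_on; rewrite !inE. Qed.

(** This keeps the zeros below the diagonal of a finished column [j] below the diagonal when the
    rows from [i] on are permuted. *)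
Lemma perm_from_gtn k (i : 'I_k) (s : 'S_k) (j : nat) (l : 'I_k) :
  perm_on [set j : 'I_k | (i <= j)%N]%SET s -> (j < i)%N -> (j < l)%N ->
  (j < s l)%N.
Proof.
move=> s_on ji jl; have [il|li] := leqP i l.
  by apply: leq_trans ji _; rewrite (perm_from_leq _ s_on).
by rewrite (perm_from_ltn s_on).
Qed.

(** The transposition of [i] with a maximiser of [F] among the indices from [i] on suffices. It
    shows that neither reordering step can get stuck. *)
Lemma exists_perm_max (R : realType) k (i : 'I_k) (F : 'I_k -> R) :
  (forall j, 0 <= F j) ->
  exists2 s : 'S_k, perm_on [set j : 'I_k | (i <= j)%N]%SET s &
    F (s i) = \big[Num.max/0]_(j < k | (i <= j)%N) F (s j).
Proof.
move=> F_ge0.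
have [j ij jmax] := arg_maxP (P := fun j : 'I_k => (i <= j)%N) F (leqnn i).
have t_on : perm_on [set j : 'I_k | (i <= j)%N]%SET (tperm i j).
  apply/fintype.subsetP => l; rewrite !inE.
  by case: tpermP => [->|->|]; rewrite ?eqxx.
exists (tperm i j) => //; apply: le_anti.
rewrite (le_bigmax_cond _ (fun l => F (tperm i j l))) //=.
apply/bigmax_leP; split=> // l il; rewrite tpermL; apply: jmax.
by rewrite (perm_from_leq _ t_on).
Qed.

(** * Lattices and changes of lattice basis *)

Section Lattice.
Variables (p : nat) (p_pr : prime p) (V : vectType (padic p_pr)).
Implicit Types (v w : V).

Lemma lattice_mem k (b : k.-tuple V) i : lattice b (tnth b i).
Proof.
exists (fun j => if j == i then 1 else 0).
rewrite (bigD1 i) //= eqxx tofrac1 scale1r big1 ?addr0 // => j /negPf ->.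
by rewrite tofrac0 scale0r.
Qed.

Lemma lattice0 k (b : k.-tuple V) : lattice b 0.
Proof.
by exists (fun=> 0); rewrite big1 // => i _; rewrite tofrac0 scale0r.
Qed.

Lemma latticeD k (b : k.-tuple V) v w :
  lattice b v -> lattice b w -> lattice b (v + w).
Proof.
move=> [x ->] [y ->]; exists (fun i => x i + y i); rewrite -big_split /=.
by apply: eq_bigr => i _; rewrite tofracD scalerDl.
Qed.

Lemma latticeZ k (b : k.-tuple V) c v :
  is_padic_int c -> lattice b v -> lattice b (c *: v).
Proof.
move=> [a ->] [x ->]; exists (fun i => a * x i); rewrite scaler_sumr.
by apply: eq_bigr => i _; rewrite tofracM scalerA.
Qed.

Lemma lattice_subset k l (b : k.-tuple V) (b' : l.-tuple V) :
  (forall i, lattice b' (tnth b i)) -> (lattice b `<=` lattice b')%classic.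
Proof.
move=> bb' _ [x ->]; apply: big_ind => [||i _]; first exact: lattice0.
  exact: latticeD.
by apply: latticeZ => //; exists (x i).
Qed.

Lemma lattice_span k (b : k.-tuple V) v : lattice b v -> v \in <<b>>%VS.
Proof.
move=> [x ->]; apply: memv_suml => i _; apply/memvZ/memv_span/mem_tnth.
Qed.

(** Dimension count: [<<b'>>] contains the [k]-dimensional [<<b>>] and is spanned by [k] vectors. *)
Lemma lattice_eq_free k (b b' : k.-tuple V) :
  lattice b = lattice b' -> free b -> free b'.
Proof.
move=> eqL; rewrite /free !size_tuple => /eqP dim_b.
have := dim_span b'; rewrite size_tuple eqn_leq => -> /=.
rewrite -[leqLHS]dim_b dimvS //.
apply/span_subvP => _ /tnthP[i ->]; apply: lattice_span; rewrite -eqL.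
exact: lattice_mem.
Qed.

Lemma reorders_lattice k (i : 'I_k) (b b' : k.-tuple V) :
  reorders_from i b b' -> lattice b' = lattice b.
Proof.
move=> [s [_ ->]]; apply/seteqP; split; apply: lattice_subset => j.
  rewrite tnth_mktuple; exact: lattice_mem.
have := lattice_mem [tuple tnth b (s j) | j < k] ((s^-1)%g j).
by rewrite tnth_mktuple permKV.
Qed.

End Lattice.

(** * Ultrametric estimates and coordinates *)

Section Norm.
Variables (R : realType) (p : nat) (p_pr : prime p).
Variables (V : vectType (padic p_pr)) (N : V -> R).
Hypothesis N_norm : is_norm N.
Implicit Types (v w : V).

Lemma norm0 : N 0 = 0. Proof. exact/(norm_eq0 N_norm). Qed.

Lemma norm_gt0 v : v != 0 -> 0 < N v.
Proof.
rewrite lt_def (norm_ge0 N_norm) andbT; apply: contra => /eqP.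
by move/(norm_eq0 N_norm)->.
Qed.

Lemma norm_integralZ_le c v : is_padic_int c -> N (c *: v) <= N v.
Proof.
move=> /(padic_abs_le1 R) c1.
by rewrite (normZ N_norm) ler_piMl ?(norm_ge0 N_norm).
Qed.

Lemma norm_sum_le (I : finType) (P : pred I) (F : I -> V) :
  N (\sum_(i | P i) F i) <= \big[Num.max/0]_(i | P i) N (F i).
Proof.
elim/big_ind2: _ => [|x1 x2 y1 y2 le1 le2|//]; first by rewrite norm0.
apply: le_trans (normD N_norm _ _) _.
by rewrite ge_max !le_max le1 le2 orbT.
Qed.

Lemma norm_le_addr v w : N w < N v -> N v <= N (v + w).
Proof.
(* Writing [v = (v + w) - w] bounds [N v] by [N (v + w)] or by [N (- w)]; the latter is at most
   [N w < N v], because -1 is a p-adic integer. *)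
move=> lt_wv; have := normD N_norm (v + w) (- w); rewrite addrK le_max.
case/orP=> // le_v; suff: N v < N v by rewrite ltxx.
apply: le_lt_trans le_v (le_lt_trans _ lt_wv); rewrite -scaleN1r.
by apply: norm_integralZ_le; exists (-1); rewrite rmorphN1.
Qed.

Lemma sum_coord_basis n (e : n.-tuple V) v :
  basis_of fullv e -> v = \sum_(j < n) coord e j v *: tnth e j.
Proof.
move=> e_basis; rewrite {1}(coord_basis e_basis (memvf v)).
by apply: eq_bigr => j _; rewrite (tnth_nth 0).
Qed.

Lemma coord_sum_tnth n (e : n.-tuple V) (x : 'I_n -> padic p_pr) j :
  free e -> coord e j (\sum_(i < n) x i *: tnth e i) = x j.
Proof.
move=> e_free; rewrite -[RHS](coord_sum_free x j e_free); congr (coord e j _).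
by apply: eq_bigr => i _; rewrite (tnth_nth 0).
Qed.

Lemma basis_reorder n (e : n.-tuple V) (s : 'S_n) :
  basis_of fullv e -> basis_of fullv [tuple tnth e (s j) | j < n].
Proof.
move=> e_basis; rewrite (perm_basis (Y := e)) //.
by apply/tuple_permP; exists s.
Qed.

(** Expand [v] in [e], reindex the sum by [s], and read off the coefficient by freeness of the
    reordered basis. *)
Lemma coord_reorder n (e : n.-tuple V) (s : 'S_n) j v :
  basis_of fullv e ->
  coord [tuple tnth e (s j) | j < n] j v = coord e (s j) v.
Proof.
move=> e_basis; rewrite {1}(sum_coord_basis v e_basis) (reindex_perm s) /=.
under eq_bigr => i _.
  rewrite (_ : tnth e (s i) = tnth [tuple tnth e (s j) | j < n] i); last first.
    by rewrite tnth_mktuple.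
  over.
apply: (coord_sum_tnth (fun i => coord e (s i) v)).
exact/basis_free/basis_reorder.
Qed.

(** * Orthogonal bases and the triangular criterion *)

Section OrthogonalBasis.
Variables (n : nat) (e : n.-tuple V).
Hypothesis e_orth : orthogonal_basis N fullv e.

Lemma norm_orthogonal v :
  N v = \big[Num.max/0]_(j < n) N (coord e j v *: tnth e j).
Proof.
by case: e_orth => e_basis <-; rewrite -sum_coord_basis.
Qed.

Lemma norm_coord_le j v : N (coord e j v *: tnth e j) <= N v.
Proof.
rewrite (norm_orthogonal v).
exact: (le_bigmax_cond _ (fun j => N (coord e j v *: tnth e j))).
Qed.

Lemma orthogonal_basis_reorder (s : 'S_n) :
  orthogonal_basis N fullv [tuple tnth e (s j) | j < n].
Proof.
split=> [|x]; first exact: basis_reorder e_orth.1.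
(* Both sides become expressions in [e] itself, with coefficients [x] composed with the inverse of
   [s]. *)
rewrite (reindex_perm s^-1) [RHS](reindex_perm s^-1) /=.
under eq_bigr => j _ do rewrite tnth_mktuple permKV.
under [RHS]eq_bigr => j _ do rewrite tnth_mktuple permKV.
by case: e_orth => _ ->.
Qed.

Lemma triangular_orthogonal m (le_mn : (m <= n)%N) (b : m.-tuple V) :
  let w := widen_ord le_mn in
  (forall l, N (tnth b l) = N (coord e (w l) (tnth b l) *: tnth e (w l))) ->
  (forall j l : 'I_m, (j < l)%N -> coord e (w j) (tnth b l) = 0) ->
  forall x : 'I_m -> padic p_pr,
    N (\sum_(i < m) x i *: tnth b i) =
    \big[Num.max/0]_(i < m) N (x i *: tnth b i).
Proof.
move=> w b_diag b_zero x; set F := fun i => N (x i *: tnth b i).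
apply: le_anti; rewrite norm_sum_le /=.
apply/bigmax_leP; split=> [|k _]; first exact: (norm_ge0 N_norm).
pose P i := [forall j, F j <= F i].
have [k1 Pk1] : exists k1, P k1.
  have [k1 _ k1max] := arg_maxP F (erefl (predT k)).
  by exists k1; apply/forallP => j; apply: k1max.
have [l /forallP l_max l_min] := arg_minnP (fun i : 'I_m => val i) Pk1.
apply: le_trans (l_max k) _.
(* The maximum over the remaining rows has default value 0, so bounding it strictly by [F l]
   requires [F l] to be positive. *)
have [->|Fl0] := eqVneq (F l) 0; first exact: (norm_ge0 N_norm).
have Fl_gt0 : 0 < F l by rewrite lt_def Fl0 (norm_ge0 N_norm).
apply: le_trans (norm_coord_le (w l) _).
have Fcoord i : N (coord e (w l) (x i *: tnth b i) *: tnth e (w l)) <= F i.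
  exact: norm_coord_le.
have FlE : F l = N (coord e (w l) (x l *: tnth b l) *: tnth e (w l)).
  by rewrite linearZ /= -scalerA (normZ N_norm) -b_diag -(normZ N_norm).
rewrite linear_sum scaler_suml (bigD1 l) //= FlE; apply: norm_le_addr.
rewrite -FlE; apply: le_lt_trans (norm_sum_le _ _) _.
apply/bigmax_ltP; split=> // i il.
case: (ltngtP i l) => [i_lt_l|l_lt_i|/val_inj/eqP].
(* If [F i] reached [F l], then [i] would be a maximiser smaller than [l]. *)
- apply: le_lt_trans (Fcoord i) _; rewrite ltNge; apply/negP => le_li.
  suff: (l <= i)%N by rewrite leqNgt i_lt_l.
  by apply: l_min; apply/forallP => j; apply: le_trans (l_max j) le_li.
- by rewrite linearZ /= b_zero // mulr0 scale0r norm0.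
- by rewrite (negPf il).
Qed.

End OrthogonalBasis.
End Norm.

(** * The loop invariant and the two reordering steps *)

Section Procedure.
Variables (R : realType) (p : nat) (p_pr : prime p).
Variables (V : vectType (padic p_pr)) (N : V -> R).
Hypothesis N_norm : is_norm N.
Variables (m n : nat) (le_mn : (m <= n)%N) (alpha : m.-tuple V).
Hypothesis alpha_free : free alpha.
Implicit Types (al : m.-tuple V) (e : n.-tuple V).

Local Notation w := (widen_ord le_mn).

(** The invariant after [k] passes. At [k = m] its last two clauses are the hypotheses of
    [triangular_orthogonal]; the lattice clause also carries freeness along from [alpha]. *)
Record reduced k al e : Prop := Reduced {
  reduced_basis : orthogonal_basis N fullv e;
  reduced_lattice : lattice al = lattice alpha;
  reduced_diag : forall j : 'I_m, (j < k)%N ->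
    N (tnth al j) = N (pivot le_mn al e j *: tnth e (w j));
  reduced_zero : forall j l : 'I_m, (j < k)%N -> (j < l)%N ->
    coord e (w j) (tnth al l) = 0 }.

Lemma reduced_step_a (i : 'I_m) al al' e :
  reduced i al e -> step_a N i al al' -> reduced i al' e.
Proof.
move=> [e_orth eqL diag zero] [reord _].
split=> //; first by rewrite (reorders_lattice reord).
  move=> j ji; case: reord => s [s_on ->].
  by rewrite /pivot tnth_mktuple (perm_from_ltn s_on ji); apply: diag.
move=> j l ji jl; case: reord => s [s_on ->].
by rewrite tnth_mktuple zero // (perm_from_gtn s_on).
Qed.

Lemma reduced_step_b (i : 'I_m) al e e' :
  reduced i al e -> step_b N le_mn i al e e' -> reduced i al e'.
Proof.
move=> [e_orth eqL diag zero] [[s [s_on ->]] _].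
have sw (j : 'I_m) : (j < i)%N -> s (w j) = w j.
  by move=> ji; apply: (perm_from_ltn s_on).
split=> //; first exact: orthogonal_basis_reorder.
  move=> j ji.
  by rewrite /pivot (coord_reorder _ _ _ e_orth.1) // tnth_mktuple sw // diag.
by move=> j l ji jl; rewrite (coord_reorder _ _ _ e_orth.1) // sw // zero.
Qed.

Lemma step_a_exists (i : 'I_m) al : exists al', step_a N i al al'.
Proof.
have [s s_on s_max] :=
  exists_perm_max i (fun j => norm_ge0 N_norm (tnth al j)).
exists [tuple tnth al (s j) | j < m]; split; first by exists s.
rewrite tnth_mktuple s_max; apply: eq_bigr => j _.
by rewrite tnth_mktuple.
Qed.

Lemma step_b_exists (i : 'I_m) al e :
  orthogonal_basis N fullv e -> exists e', step_b N le_mn i al e e'.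
Proof.
move=> e_orth; pose F j := N (coord e j (tnth al i) *: tnth e j).
have [s s_on s_max] :=
  @exists_perm_max R n (w i) F (fun j => norm_ge0 N_norm _).
exists [tuple tnth e (s j) | j < n]; split; first by exists s.
rewrite tnth_mktuple (coord_reorder _ _ _ e_orth.1) // -/(F _) s_max.
apply: eq_bigr => j _; rewrite tnth_mktuple.
by rewrite (coord_reorder _ _ _ e_orth.1).
Qed.

(** * The elimination step of one pass *)

Section Pass.
Variables (i : 'I_m) (al : m.-tuple V) (e0 e : n.-tuple V).
Hypothesis red : reduced i al e.
Hypothesis al_max :
  N (tnth al i) = \big[Num.max/0]_(k < m | (i <= k)%N) N (tnth al k).
Hypothesis e_max : step_b N le_mn i al e0 e.

(** By orthogonality the norm is the largest norm of a component. Components before [i] vanish by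
    the invariant, and step (b) makes the one at [i] dominate the rest. *)
Lemma pivot_norm : N (tnth al i) = N (pivot le_mn al e i *: tnth e (w i)).
Proof.
have e_orth := reduced_basis red; apply: le_anti.
rewrite [X in _ && X](norm_coord_le e_orth) andbT (norm_orthogonal e_orth).
apply/bigmax_leP; split=> [|j _]; first exact: (norm_ge0 N_norm).
have [ij|ji] := leqP i j.
  case: e_max => _ ->.
  exact: (le_bigmax_cond _ (fun j => N (coord e j (tnth al i) *: tnth e j))).
(* The invariant concerns only columns that match a row index; [j < i < m] makes [j] one of them. *)
have jm := ltn_trans ji (ltn_ord i).
have ->: j = w (Ordinal jm) by apply: val_inj.
by rewrite (reduced_zero red) // scale0r norm0 // (norm_ge0 N_norm).
Qed.

Lemma pivot_norm_gt0 : 0 < N (pivot le_mn al e i *: tnth e (w i)).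
Proof.
rewrite -pivot_norm; apply: norm_gt0 => //.
(* The current vectors generate the same lattice as [alpha], hence are free and in particular
   nonzero. *)
have al_free := lattice_eq_free (esym (reduced_lattice red)) alpha_free.
exact: free_not0 al_free (mem_tnth _ _).
Qed.

Lemma pivot_neq0 : pivot le_mn al e i != 0.
Proof.
by apply: contraTneq pivot_norm_gt0 => ->; rewrite scale0r norm0 // ltxx.
Qed.

Lemma multiplier_integral (l : 'I_m) :
  (i < l)%N -> is_padic_int (multiplier le_mn al e i l).
Proof.
move=> il; apply/(padic_abs_le1 R).
rewrite -(ler_pM2r pivot_norm_gt0) mul1r -(normZ N_norm).
rewrite scalerA divfK ?pivot_neq0 //.
apply: le_trans (norm_coord_le (reduced_basis red) _ _) _.
rewrite -pivot_norm al_max.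
exact: (le_bigmax_cond _ (fun k => N (tnth al k)) (ltnW il)).
Qed.

(** The step is undone by adding back the same integral multiples of row [i], which it leaves
    unchanged. *)
Lemma step_c_lattice : lattice (step_c le_mn i al e) = lattice al.
Proof.
have multL k (b : k.-tuple V) c v v' :
    is_padic_int c -> lattice b v -> lattice b v' -> lattice b (v + c *: v').
  by move=> c_int bv bv'; apply: latticeD => //; apply: latticeZ.
apply/seteqP; split; apply: lattice_subset => l.
  rewrite tnth_mktuple; case: ifP => il; last exact: lattice_mem.
  rewrite -scaleNr; apply: multL (lattice_mem _ _) (lattice_mem _ _).
  have [a ->] := multiplier_integral il.
  by exists (- a); rewrite rmorphN.
have := lattice_mem (step_c le_mn i al e) l.
rewrite tnth_mktuple; case: ifP => // il al_l.
rewrite -[tnth al l](subrK (multiplier le_mn al e i l *: tnth al i)).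
apply: multL (multiplier_integral il) al_l _.
by have := lattice_mem (step_c le_mn i al e) i; rewrite tnth_mktuple ltnn.
Qed.

(** Rows up to [i] do not change, so the only new diagonal condition is [pivot_norm]. In columns
    before [i], row [i] and the rows below it are already zero, so subtraction preserves the zeros;
    in column [i] the multiplier is chosen to cancel. *)
Lemma reduced_step_c : reduced i.+1 (step_c le_mn i al e) e.
Proof.
have [e_orth eqL diag zero] := red.
split=> //; first by rewrite step_c_lattice.
  move=> j; rewrite ltnS => ji; rewrite /pivot tnth_mktuple ltnNge ji /=.
  case: (ltngtP j i) ji => // [ji _|/val_inj -> _]; first exact: diag.
  exact: pivot_norm.
move=> j l; rewrite ltnS => ji jl; rewrite tnth_mktuple.
case: (ltngtP j i) ji => // [ji _|/val_inj ji _].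
  by case: ifP => il; rewrite ?linearB ?linearZ /= !zero // mulr0 subr0.
by rewrite -ji jl linearB linearZ /= divfK ?subrr // ji pivot_neq0.
Qed.

End Pass.

Lemma run_reduced e k al' e' : orthogonal_basis N fullv e ->
  run N le_mn alpha e k al' e' -> reduced k al' e'.
Proof.
move=> e_orth; elim=> [|i al0 e0 al1 e1 _ red st_a st_b].
  by split=> // j.
have red1 := reduced_step_b (reduced_step_a red st_a) st_b.
by apply: reduced_step_c red1 _ st_b; case: st_a.
Qed.

End Procedure.

Theorem theorem6p1 (R : realType) (p : nat) (p_pr : prime p)
    (V : vectType (padic p_pr)) (n : nat) (n_gt0 : (0 < n)%N)
    (dimV : \dim (@fullv _ V) = n)
    (N : V -> R) (N_norm : is_norm N)
    (e : n.-tuple V) (e_orth : orthogonal_basis N fullv e)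
    (m : nat) (le_mn : (m <= n)%N)
    (alpha : m.-tuple V) (alpha_free : free alpha) :
  well_defined N le_mn alpha e /\
  forall (beta : m.-tuple V) (e' : n.-tuple V),
    run N le_mn alpha e m beta e' ->
    orthogonal_lattice_basis N (lattice alpha) beta.
Proof.
split=> [i al0 e0 /(run_reduced N_norm alpha_free e_orth) red|beta e'].
  split=> [|al1 st_a]; first exact: step_a_exists.
  have red_a := reduced_step_a red st_a; case: (st_a) => _ al_max.
  split=> [|e1 st_b]; first exact: step_b_exists (reduced_basis red_a).
  have red_b := reduced_step_b red_a st_b.
  split=> [|l]; first exact: (pivot_neq0 N_norm alpha_free red_b st_b).
  exact: (multiplier_integral N_norm alpha_free red_b al_max st_b).
(* After [m] passes the bound [j < m] in the invariant holds for every row index. *)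
move=> /(run_reduced N_norm alpha_free e_orth)[e'_orth eqL diag zero].
have beta_free := lattice_eq_free (esym eqL) alpha_free.
split; first by split.
split; first by rewrite /basis_of eqxx.
apply: (triangular_orthogonal N_norm e'_orth (le_mn := le_mn)) => [l|j l jl].
  exact: diag.
exact: zero.
Qed.
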